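(* Let $\Delta$ be a simplicial complex on $X=\{x_1,\dots,x_n\}$ of dimension $d=\dim(\Delta)$, let $s$ be a positive integer, and let $\alpha=(s,s,\dots,s)$ (with $n$ entries). Let $K$ be a field and let $I(\Delta)\subseteq K[x_1,\dots,x_n]$ and $I(\Delta^\alpha)\subseteq K[x_{ij}: 1\le i\le n,\ 1\le j\le s]$ be the facet ideals of $\Delta$ and of its expansion $\Delta^\alpha$. If $I(\Delta)$ has linear quotients, then $$\mathrm{pd}(I(\Delta^\alpha))\le \mathrm{pd}(I(\Delta))\,s+(d+1)(s-1).$$ Moreover, if in addition $\Delta$ is pure, then $$\mathrm{pd}(I(\Delta^\alpha))=\mathrm{pd}(I(\Delta))\,s+(d+1)(s-1).$$
   Context: Simplicial complexes are finite and contain the empty face; $\mathcal F(\Delta)$ is the set of facets (maximal faces) of $\Delta$. $\dim(\Delta)=\max\{|F|-1: F\in\Delta\}$, and $\Delta$ is pure if all its facets have the same cardinality. Expansion: for $\alpha=(k_1,\dots,k_n)$ with positive integer entries put $X^\alpha=\{x_{ij}: 1\le i\le n,\ 1\le j\le k_i\}$. The expansion $\Delta^\alpha$ is the simplicial complex on $X^\alpha$ whose facets are the sets $\{x_{i_1j_1},\dots,x_{i_rj_r}\}$ with $\{x_{i_1},\dots,x_{i_r}\}\in\mathcal F(\Delta)$ (distinct $i_1,\dots,i_r$) and $1\le j_m\le k_{i_m}$ for all $m$. Facet ideal: for a complex $\Gamma$ on a set of variables, $I(\Gamma)=(x^F: F\in\mathcal F(\Gamma))$ with $x^F=\prod_{x\in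 F}x$, in the polynomial ring over $K$ on all these variables. A monomial ideal $I$ of a polynomial ring has linear quotients if its minimal monomial generators can be ordered $f_1,\dots,f_m$ so that for every $2\le i\le m$ the colon ideal $(f_1,\dots,f_{i-1}):(f_i)$ is generated by a subset of the variables. $\mathrm{pd}(M)=\max\{i:\beta_{i,j}(M)\neq0\text{ for some }j\}$ is the projective dimension of $M$ over the polynomial ring in which the ideal lives. *)

(* Defs.v *)
From Stdlib Require Import ClassicalEpsilon.
From HB Require Import structures.
From mathcomp Require Import all_boot all_order all_algebra.
From mathcomp Require Import mpoly.

Set Implicit Arguments.
Unset Strict Implicit.
Unset Printing Implicit Defensive.

Import Order.TTheory GRing.Theory Num.Theory.
Local Open Scope ring_scope.

Section Complexes.
Variable V : finType.
Implicit Type D : {set {set V}}.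

Definition simplicial_complex D : Prop :=
  set0 \in D /\ (forall F G : {set V}, F \in D -> G \subset F -> G \in D).

Definition facets D : {set {set V}} :=
  [set F | maxset (fun G => G \in D) F].

(* An integer, since dim {set0} = -1. *)
Definition cdim D : int := (\max_(F in D) #|F|)%N%:Z - 1.

Definition pure_complex D : Prop :=
  forall F G : {set V}, F \in facets D -> G \in facets D -> #|F| = #|G|.

(* The variable x_{v j} is the pair (v, j), with j in {0, ..., alpha v - 1}. *)
Definition expansion_facets D (alpha : V -> nat) :
    {set {set {v : V & 'I_(alpha v)}}} :=
  [set G : {set {v : V & 'I_(alpha v)}} |
    dinjectiveb tag (mem G) & [set tag u | u in G] \in facets D].

Definition expansion D (alpha : V -> nat) :
    {set {set {v : V & 'I_(alpha v)}}} :=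
  [set H : {set {v : V & 'I_(alpha v)}} |
    [exists G in expansion_facets D alpha, H \subset G]].

End Complexes.

Lemma facets_expansion (V : finType) (D : {set {set V}}) (alpha : V -> nat) :
  facets (expansion D alpha) = expansion_facets D alpha.
Proof.
have sub_exp G : G \in expansion_facets D alpha -> G \in expansion D alpha.
  by move=> hG; rewrite inE; apply/existsP; exists G; rewrite hG subxx.
apply/setP=> G; rewrite [in LHS]inE; apply/maxsetP/idP => [[]|hG].
  rewrite inE => /existsP[H /andP[hH sGH]] maxG.
  by rewrite -(maxG H (sub_exp _ hH) sGH).
split=> [|H]; first exact: sub_exp.
rewrite inE => /existsP[H' /andP[hH' sHH']] sGH.
have sGH' := subset_trans sGH sHH'.
have eqG : G = H'.
  move: hG hH'; rewrite !inE => /andP[/dinjectiveP iG +] /andP[/dinjectiveP iH].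
  move=> /maxsetP[_ mG] /maxsetP[Hd _]; apply/eqP; rewrite eqEcard sGH' /=.
  by rewrite -(card_in_imset iH) (mG _ Hd (imsetS _ sGH')) card_in_imset.
by apply/eqP; rewrite eqEsubset sGH andbT eqG.
Qed.

Lemma simplicial_complex_expansion (V : finType) (D : {set {set V}})
    (alpha : V -> nat) :
  simplicial_complex D -> (forall v, 0 < alpha v)%N ->
  simplicial_complex (expansion D alpha).
Proof.
move=> [D0 _] alpha_gt0; split; last first.
  move=> F G; rewrite !inE => /existsP[H /andP[hH sFH]] sGF.
  by apply/existsP; exists H; rewrite hH (subset_trans sGF).
have [F maxF _] := @maxset_exists _ (fun G => G \in D) _ D0.
pose x v : {v : V & 'I_(alpha v)} := Tagged (fun v => 'I_(alpha v)) (Ordinal (alpha_gt0 v)).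
rewrite inE; apply/existsP; exists (x @: F); rewrite sub0set andbT inE.
apply/andP; split.
  by apply/dinjectiveP=> _ _ /imsetP[u _ ->] /imsetP[v _ ->] /= ->.
by rewrite -imset_comp imset_id inE.
Qed.

Section Ideals.
Variable R : comNzRingType.
Implicit Type I : R -> Prop.

Definition ideal_gen (gs : seq R) : R -> Prop :=
  fun f => exists c : nat -> R, f = \sum_(i < size gs) c i * gs`_i.

Definition colon I (f : R) : R -> Prop := fun g => I (g * f).

End Ideals.

(* The polynomial ring on the variables V is {mpoly K[#|V|]}, the variable
   v being 'X_(enum_rank v). *)
Definition facet_ideal (K : fieldType) (V : finType) (D : {set {set V}}) :
    {mpoly K[#|V|]} -> Prop :=
  ideal_gen [seq \prod_(v in F) 'X_(enum_rank v) | F : {set V} in facets D].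
Arguments facet_ideal K {V} D.

Section MonomialIdeals.
Variables (K : fieldType) (n : nat).
Implicit Type I : {mpoly K[n]} -> Prop.

(* For a monomial ideal, its minimal monomial generators are the monomials it
   contains that are minimal for divisibility. *)
Definition min_generator I (m : 'X_{1..n}) : Prop :=
  I 'X_[m] /\
  (forall m' : 'X_{1..n}, I 'X_[m'] -> (m' <= m)%MM -> m' = m).

Definition linear_quotients I : Prop :=
  exists fs : seq 'X_{1..n},
    [/\ uniq fs,
        forall m, m \in fs <-> min_generator I m &
        forall i, (0 < i < size fs)%N ->
          exists Y : {set 'I_n}, forall g : {mpoly K[n]},
            colon (ideal_gen [seq 'X_[m] | m <- take i fs])
                  'X_[nth 0%MM fs i] g
            <-> ideal_gen [seq 'X_v | v in Y] g].

(* A sequence of graded free modules F_i = (+)_(k < rk i) S(-deg i k), with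
   S = {mpoly K[n]}, maps F_(i+1) -> F_i and an augmentation F_0 -> S. Elements
   of F_i are row vectors and the maps are v |-> v *m A. *)
Record graded_free_complex := GradedFreeComplex {
  rk : nat -> nat;
  deg : forall i, 'I_(rk i) -> nat;
  diff : forall i, 'M[{mpoly K[n]}]_(rk i.+1, rk i);
  aug : 'cV[{mpoly K[n]}]_(rk 0) }.

Record minimal_graded_free_resolution I (F : graded_free_complex) : Prop := {
  (* the maps are homogeneous of degree 0 *)
  diff_homog : forall i k l m, m \in msupp (diff F i k l) ->
    (mdeg m + deg l)%N = deg k;
  aug_homog : forall k, aug F k 0 \is (deg k).-homog;
  (* exactness of ... -> F_1 -> F_0 -> I -> 0 *)
  aug_image : forall f, I f <-> exists v : 'rV_(rk F 0), f%:M = v *m aug F;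
  aug_exact : forall v : 'rV_(rk F 0),
    v *m aug F = 0 <-> exists w : 'rV_(rk F 1), v = w *m diff F 0;
  diff_exact : forall i (v : 'rV_(rk F i.+1)),
    v *m diff F i = 0 <-> exists w : 'rV_(rk F i.+2), v = w *m diff F i.+1;
  (* minimality: entries lie in the ideal generated by the variables *)
  diff_min : forall i k l, (diff F i k l)@_0%MM = 0 }.

(* The graded Betti number beta_(i,j)(I): the number of summands S(-j) in F_i,
   where F is a minimal graded free resolution of I. *)
Definition betti I (i j : nat) : nat :=
  epsilon (inhabits 0%N) (fun b => exists F : graded_free_complex,
    minimal_graded_free_resolution I F /\ b = #|[set k : 'I_(rk F i) | deg k == j]|).

(* The projective dimension max {i | beta_(i,j)(I) != 0 for some j}. *)
Definition pd I : nat :=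
  epsilon (inhabits 0%N) (fun p =>
    (exists j, betti I p j != 0%N) /\
    (forall i j, betti I i j != 0%N -> (i <= p)%N)).

End MonomialIdeals.

(* Main.v *)
(* Let F_1, ..., F_m be the facets, in an order giving linear quotients, and let
   Q_p be the set of variables generating the p-th colon ideal. Such an order can
   be made nondecreasing in cardinality; then the mapping cone of the Koszul
   complex on Q_p over the resolution of (x^F_1, ..., x^F_(p-1)) is minimal for
   degree reasons, so pd = max_p #|Q_p|, as graded Betti numbers do not depend on
   the resolution. In the expansion, order the facets {x_(v c(v)) : v in F_p}
   first by p, then by the sum of the c(v): the quotient variables are the s
   copies of each element of Q_p and the x_(v j) with v in F_p and j < c(v). There
   are at most s #|Q_p| + (s - 1) #|F_p| of them, with equality when all c(v) are
   maximal. *)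
Require Import Defs.
From Stdlib Require Import ClassicalEpsilon.
From mathcomp Require Import all_boot all_order all_algebra.
From mathcomp Require Import mpoly.

Set Implicit Arguments.
Unset Strict Implicit.
Unset Printing Implicit Defensive.

Import Order.TTheory GRing.Theory Num.Theory.
Local Open Scope ring_scope.

(** * Uniqueness of graded Betti numbers *)

Section GradedSequences.
Variables (K : fieldType) (n : nat).
Local Notation S := {mpoly K[n]}.
Implicit Types (p q : S) (I J : S -> Prop) (F G L : graded_free_complex K n).

(* The part of degree t of p, where p is a coefficient of a generator of degree
   c; it is 0 when t < c. *)
Definition shift_part c t p : S :=
  \sum_(m <- msupp p | (mdeg m + c == t)%N) p@_m *: 'X_[m].

Lemma mcoeff_shift_part c t p m :
  (shift_part c t p)@_m = if (mdeg m + c == t)%N then p@_m else 0.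
Proof.
rewrite raddf_sum /= big_mkcond /=.
under eq_bigr => k _ do rewrite mcoeffZ mcoeffX.
have [mp|mNp] := boolP (m \in msupp p).
  rewrite (bigD1_seq m) ?msupp_uniq //= eqxx mulr1 big1 ?addr0 // => k /negPf->.
  by rewrite mulr0 if_same.
rewrite (memN_msupp_eq0 mNp) if_same big_seq big1 // => k kp.
have [km|_] := eqVneq k m; last by rewrite mulr0 if_same.
by rewrite -km kp in mNp.
Qed.

Lemma shift_part_sum c t (I : finType) (F : I -> S) :
  shift_part c t (\sum_i F i) = \sum_i shift_part c t (F i).
Proof.
apply/mpolyP => m; rewrite mcoeff_shift_part !raddf_sum /=.
under [RHS]eq_bigr => i _ do rewrite mcoeff_shift_part.
by case: ifP => // _; rewrite big1.
Qed.

(** All terms of [q] have the same degree, so the degree of a term of [p * q] is decided by its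
    factor from [p]. *)
Lemma shift_partM c c' t p q :
  (forall m, m \in msupp q -> (mdeg m + c')%N = c) ->
  shift_part c' t (p * q) = shift_part c t p * q.
Proof.
move=> hq; apply/mpolyP => m; rewrite mcoeff_shift_part !mcoeffM.
transitivity (\sum_(k : 'X_{1..n < (mdeg m).+1, (mdeg m).+1} |
   m == (k.1 + k.2)%MM) if (mdeg m + c' == t)%N then p@_k.1 * q@_k.2 else 0).
  by case: ifP => // _; rewrite big1.
apply: eq_bigr => k /eqP mE; rewrite mcoeff_shift_part.
have [qk|qk] := boolP ((k.2 : 'X_{1..n}) \in msupp q); last first.
  by rewrite (memN_msupp_eq0 qk) !mulr0 if_same.
rewrite -(hq _ qk) addnA -mdegD -(congr1 mdeg mE).
by case: ifP; rewrite ?mul0r.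
Qed.

(** Such a matrix is a degree-preserving map from the sum of the S(-(dr k + e)) to the sum of the
    S(-ds l). The twist [e] accommodates maps lifting multiplication by a form of degree e. *)
Definition mxhom e r s (dr : 'I_r -> nat) (ds : 'I_s -> nat)
    (A : 'M[S]_(r, s)) :=
  forall k l m, m \in msupp (A k l) -> (mdeg m + ds l)%N = (dr k + e)%N.

Lemma mxhom1 r (dr : 'I_r -> nat) : mxhom 0 dr dr 1%:M.
Proof.
move=> k l m; rewrite mxE; case: eqVneq => [->|_]; last by rewrite msupp0.
by rewrite msupp1 inE => /eqP->; rewrite mdeg0 addn0.
Qed.

Lemma mxhomM e e' r s t (dr : 'I_r -> nat) (ds : 'I_s -> nat)
    (dt : 'I_t -> nat) (A : 'M[S]_(r, s)) (B : 'M[S]_(s, t)) :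
  mxhom e dr ds A -> mxhom e' ds dt B -> mxhom (e + e') dr dt (A *m B).
Proof.
move=> hA hB k l m; rewrite mxE => /msupp_sum_le/flattenP[_ /mapP[j _ ->]].
move/msuppM_le/allpairsP=> [[m1 m2] /= [/hA h1 /hB h2 ->]].
by rewrite mdegD -addnA h2 [RHS]addnA -h1 addnA.
Qed.

(** Cut every entry of [X] down to the degree it ought to have. As [D] and [X *m D] are homogeneous,
    the discarded terms contribute nothing to the product. *)
Lemma mxhom_lift e r s t (dr : 'I_r -> nat) (ds : 'I_s -> nat)
    (dt : 'I_t -> nat) (X : 'M[S]_(r, s)) (D : 'M[S]_(s, t)) :
  mxhom 0 ds dt D -> mxhom e dr dt (X *m D) ->
  exists2 Y, mxhom e dr ds Y & Y *m D = X *m D.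
Proof.
move=> hD hXD; exists (\matrix_(k, l) shift_part (ds l) (dr k + e) (X k l)).
  move=> k l m; rewrite mxE mcoeff_msupp mcoeff_shift_part.
  by case: ifP => [/eqP|]; rewrite ?eqxx.
apply/matrixP => k l.
transitivity (shift_part (dt l) (dr k + e) ((X *m D) k l)); last first.
  apply/mpolyP => m; rewrite mcoeff_shift_part; case: ifP => // /eqP Nm.
  apply/esym; apply/memN_msupp_eq0; apply/negP => /hXD; exact: Nm.
rewrite !mxE shift_part_sum; apply: eq_bigr => j _; rewrite mxE.
by apply/esym/shift_partM => m /hD ->; rewrite addn0.
Qed.

Lemma row_lift r s t u (D : 'M[S]_(s, t)) (D' : 'M[S]_(u, s))
    (M : 'M[S]_(r, s)) :
  (forall v : 'rV_s, v *m D = 0 -> exists w, v = w *m D') ->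
  M *m D = 0 -> exists W, M = W *m D'.
Proof.
move=> ex MD0.
have /fin_all_exists[f hf] k : exists w, row k M = w *m D'.
  by apply: ex; rewrite -row_mul MD0 row0.
exists (\matrix_k f k); apply/row_matrixP => k.
by rewrite row_mul rowK hf.
Qed.

(** * Graded exact sequences: comparison maps and homotopies *)

Record graded_seq := GradedSeq {
  grk : nat -> nat;
  gdeg : forall i, 'I_(grk i) -> nat;
  gdiff : forall i, 'M[S]_(grk i.+1, grk i) }.

(** Exactness is asked from position 1 on: in an augmented resolution, position 0 is S, where the
    image is only the ideal. *)
Record gexact (C : graded_seq) : Prop := {
  gdiff_hom : forall i, mxhom 0 (@gdeg C i.+1) (@gdeg C i) (gdiff C i);
  gdiff_exact : forall i (v : 'rV_(grk C i.+1)),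
    v *m gdiff C i = 0 <-> exists w : 'rV_(grk C i.+2), v = w *m gdiff C i.+1 }.

Arguments gdiff_hom [C] _ i [k l m].

Lemma gdiffM C : gexact C -> forall i, gdiff C i.+1 *m gdiff C i = 0.
Proof.
move=> hC i; apply/row_matrixP => k; rewrite row_mul row0.
by apply/(gdiff_exact hC); exists (delta_mx 0 k); rewrite -rowE.
Qed.

Lemma gdiff_lift C i r (M : 'M[S]_(r, grk C i.+1)) : gexact C ->
  M *m gdiff C i = 0 -> exists W, M = W *m gdiff C i.+1.
Proof. by move=> hC; apply: row_lift => v /(gdiff_exact hC). Qed.

Section Lifting.
Variables (F G : graded_seq) (e : nat) (phi0 : 'M[S]_(grk F 0, grk G 0)).
Hypotheses (hF : gexact F) (hG : gexact G).
Hypothesis phi0_hom : mxhom e (@gdeg F 0) (@gdeg G 0) phi0.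
Hypothesis phi0_lift : exists X, gdiff F 0 *m phi0 = X *m gdiff G 0.

(** Each stage is some homogeneous solution picked by [epsilon]; that one exists at every stage is
    shown in [chain_liftP]. *)
Fixpoint chain_lift i : 'M[S]_(grk F i, grk G i) :=
  match i with
  | 0 => phi0
  | j.+1 => epsilon (inhabits 0) (fun X =>
      mxhom e (@gdeg F j.+1) (@gdeg G j.+1) X /\
      X *m gdiff G j = gdiff F j *m chain_lift j)
  end.

(** The comparison theorem. Above the bottom, [gdiff F j *m chain_lift j] is killed by the next map
    of [G], hence factors through [gdiff G j] by exactness; [mxhom_lift] makes the factor
    homogeneous. At the bottom this is [phi0_lift]. *)
Lemma chain_liftP i :
  mxhom e (@gdeg F i) (@gdeg G i) (chain_lift i) /\
  chain_lift i.+1 *m gdiff G i = gdiff F i *m chain_lift i.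
Proof.
have step j : mxhom e (@gdeg F j) (@gdeg G j) (chain_lift j) ->
    (exists X, gdiff F j *m chain_lift j = X *m gdiff G j) ->
    mxhom e (@gdeg F j.+1) (@gdeg G j.+1) (chain_lift j.+1) /\
    chain_lift j.+1 *m gdiff G j = gdiff F j *m chain_lift j.
  move=> hj [X hX].
  suff /(epsilon_spec (inhabits 0)) H : exists Y,
      mxhom e (@gdeg F j.+1) (@gdeg G j.+1) Y /\
      Y *m gdiff G j = gdiff F j *m chain_lift j by exact: H.
  have hXG : mxhom e (@gdeg F j.+1) (@gdeg G j) (X *m gdiff G j).
    by rewrite -hX; have := mxhomM (gdiff_hom hF j) hj; rewrite add0n.
  have [Y hY YE] := mxhom_lift (gdiff_hom hG j) hXG.
  by exists Y; rewrite YE hX.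
suff H j : mxhom e (@gdeg F j) (@gdeg G j) (chain_lift j) /\
    exists X, gdiff F j *m chain_lift j = X *m gdiff G j.
  by have [h1 h2] := H i; split=> //; have [] := step i h1 h2.
elim: j => [|j [h1 h2]] //; have [h3 h4] := step j h1 h2; split=> //.
apply: (gdiff_lift hG).
by rewrite -mulmxA h4 mulmxA (gdiffM hF) mul0mx.
Qed.

End Lifting.

(* That h vanishes at i = 0 matters because the augmentation gdiff C 0, unlike the
   other maps of a minimal resolution, may have nonzero constant entries. *)
Lemma null_homotopic C (theta : forall i, 'M[S]_(grk C i)) : gexact C ->
  theta 0 = 0 ->
  (forall i, theta i.+1 *m gdiff C i = gdiff C i *m theta i) ->
  forall i, exists h h', (i = 0%N -> h = 0) /\
    theta i.+1 = gdiff C i *m h + h' *m gdiff C i.+1.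
Proof.
move=> hC t0 tS i.
suff H : exists2 h : 'M_(grk C i, grk C i.+1), (i = 0%N -> h = 0) &
    (theta i.+1 - gdiff C i *m h) *m gdiff C i = 0.
  have [h h0 /(gdiff_lift hC)[h' hh']] := H.
  by exists h, h'; split=> //; rewrite -hh' addrC subrK.
elim: i => [|i [h h0 /(gdiff_lift hC)[h' hh']]].
  by exists 0 => //; rewrite mulmx0 subr0 tS t0 mulmx0.
exists h' => //; rewrite mulmxBl tS -mulmxA -hh' mulmxBr mulmxA (gdiffM hC).
by rewrite mul0mx subr0 subrr.
Qed.

(** The resolution is moved up by one place over S in degree 0, so that the augmentation is just the
    lowest differential. *)
Definition augmented (F : graded_free_complex K n) : graded_seq :=
  @GradedSeq (fun i => if i is j.+1 then rk F j else 1)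
    (fun i => match i return 'I_(if i is j.+1 then rk F j else 1) -> nat with
              | 0 => fun=> 0%N
              | j.+1 => @deg _ _ F j
              end)
    (fun i => match i return 'M_(rk F i, if i is j.+1 then rk F j else 1) with
              | 0 => aug F
              | j.+1 => diff F j
              end).

Lemma augmented_exact I F :
  minimal_graded_free_resolution I F -> gexact (augmented F).
Proof.
case=> dh ah _ ae de _; split=> [[|i]|[|i]] //.
- move=> k l m; rewrite /= (ord1 l) => mk; rewrite !addn0.
  exact: (dhomogP _ _ _ (ah k)).
- by move=> k l m /dh ->; rewrite addn0.
- exact: de.
Qed.

Lemma augmented_row_lift I F G :
  minimal_graded_free_resolution I F -> minimal_graded_free_resolution I G ->
  exists X, aug F = X *m aug G.
Proof.
move=> hF hG.
suff /fin_all_exists[f hf] k : exists w, row k (aug F) = w *m aug G.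
  exists (\matrix_k f k); apply/row_matrixP => k.
  by rewrite row_mul rowK hf.
have [w hw] : exists w, (aug F k 0)%:M = w *m aug G.
  apply/(aug_image hG)/(aug_image hF); exists (delta_mx 0 k).
  by rewrite -rowE; apply/matrixP => a b; rewrite !mxE !ord1 eqxx mulr1n.
exists w; rewrite -hw.
by apply/matrixP => a b; rewrite !mxE !ord1 eqxx mulr1n.
Qed.

(** Since [A] only joins indices of equal degree, [A *m B = 1%:M] restricts to the blocks of degree
    [j], and an identity matrix over a field cannot factor through a smaller space. *)
Lemma degree_count_leq r s (dr : 'I_r -> nat) (ds : 'I_s -> nat)
    (A : 'M[K]_(r, s)) (B : 'M[K]_(s, r)) j :
  (forall k l, A k l != 0 -> ds l = dr k) -> A *m B = 1%:M ->
  (#|[set k | dr k == j]| <= #|[set l | ds l == j]|)%N.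
Proof.
move=> hA AB1; set P := [set k | _]; set Q := [set l | _].
apply: (@mulmx1_min K _ _ (mxsub (@enum_val _ (mem P)) (@enum_val _ (mem Q)) A)
  (mxsub (@enum_val _ (mem Q)) (@enum_val _ (mem P)) B)).
apply/matrixP => a b; rewrite mxE.
transitivity ((A *m B) (enum_val a) (enum_val b)); last first.
  by rewrite AB1 !mxE (inj_eq enum_val_inj).
rewrite mxE (bigID (mem Q)) /= [X in _ = _ + X]big1 ?addr0; last first.
  move=> l; rewrite inE => lQ; have := enum_valP a; rewrite inE => /eqP ka.
  have [->|/hA hl] := eqVneq (A (enum_val a) l) 0; first by rewrite mul0r.
  by rewrite hl ka eqxx in lQ.
by rewrite [RHS]big_enum_val; apply: eq_bigr => l _; rewrite !mxE.
Qed.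

(** Lift the identity of S in both directions. The composite [phi i *m psi i] is homotopic to the
    identity, and by minimality the homotopy terms vanish modulo the variables. So the constant
    parts of [phi] and [psi] compose to an identity matrix over the field, and constants preserve
    degrees. *)
Lemma betti_count_leq I F G i j :
  minimal_graded_free_resolution I F -> minimal_graded_free_resolution I G ->
  (#|[set k : 'I_(rk F i) | deg k == j]| <=
   #|[set k : 'I_(rk G i) | deg k == j]|)%N.
Proof.
move=> hF hG; have eF := augmented_exact hF; have eG := augmented_exact hG.
have [X hX] := augmented_row_lift hF hG.
have [Y hY] := augmented_row_lift hG hF.
have h1 := @mxhom1 1 (fun=> 0%N).
have iX : exists X, gdiff (augmented F) 0 *m 1%:M = X *m gdiff (augmented G) 0.
  by exists X; rewrite mulmx1.
have iY : exists X, gdiff (augmented G) 0 *m 1%:M = X *m gdiff (augmented F) 0.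
  by exists Y; rewrite mulmx1.
have hphi := @chain_liftP (augmented F) (augmented G) 0 1%:M eF eG h1 iX.
have hpsi := @chain_liftP (augmented G) (augmented F) 0 1%:M eG eF h1 iY.
set phi := chain_lift _ _ in hphi; set psi := chain_lift _ _ in hpsi.
pose theta i : 'M_(grk (augmented F) i) := phi i *m psi i - 1%:M.
have [||h [h' [h0 thetaE]]] := @null_homotopic (augmented F) theta eF _ _ i.
- by rewrite /theta mulmx1 subrr.
- move=> k; rewrite mulmxBl mul1mx mulmxBr mulmx1 -mulmxA (hpsi k).2 mulmxA.
  by rewrite (hphi k).2 mulmxA.
pose c := @mcoeff n K 0%MM.
have cdiff k : map_mx c (diff F k) = 0.
  by apply/matrixP => a b; rewrite !mxE; apply: (diff_min hF).
have ctheta : map_mx c (theta i.+1) = 0.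
  rewrite thetaE map_mxD !map_mxM /= cdiff mulmx0 addr0.
  by case: i h h0 {h' thetaE} => [|k] h h0; [rewrite h0 // map_mx0 mulmx0
    | rewrite cdiff mul0mx].
apply: (@degree_count_leq _ _ _ _ (map_mx c (phi i.+1)) (map_mx c (psi i.+1))).
  move=> k l; rewrite mxE -mcoeff_msupp => /((hphi i.+1).1 k l).
  by rewrite mdeg0 addn0.
apply/eqP; rewrite -subr_eq0 -map_mxM -(map_mx1 c) -map_mxB -/(theta i.+1).
by rewrite ctheta.
Qed.

Lemma betti_resolution I F i j : minimal_graded_free_resolution I F ->
  betti I i j = #|[set k : 'I_(rk F i) | deg k == j]|.
Proof.
move=> hF; rewrite /betti; set P := (X in epsilon _ X).
have [] : P (epsilon (inhabits 0%N) P).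
  by apply: epsilon_spec; exists #|[set k : 'I_(rk F i) | deg k == j]|, F.
by move=> G [hG ->]; apply/eqP; rewrite eqn_leq !(@betti_count_leq I).
Qed.

Lemma pd_resolution I F (p : nat) : minimal_graded_free_resolution I F ->
  (forall i, (0 < rk F i)%N = (i <= p)%N) -> pd I = p.
Proof.
move=> hF rkF.
have top : exists j, betti I p j != 0%N.
  have rp : (0 < rk F p)%N by rewrite rkF.
  exists (deg (Ordinal rp)); rewrite (betti_resolution _ _ hF) -lt0n.
  by apply/card_gt0P; exists (Ordinal rp); rewrite inE.
have bound i j : betti I i j != 0%N -> (i <= p)%N.
  rewrite (betti_resolution _ _ hF) -lt0n => /card_gt0P[k _].
  by rewrite -rkF (leq_ltn_trans _ (ltn_ord k)).
rewrite /pd; set P := (X in epsilon _ X).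
have [[j /bound le_p] max_pd] : P (epsilon (inhabits 0%N) P).
  by apply: epsilon_spec; exists p; split.
by apply/eqP; rewrite eqn_leq le_p; have [k /max_pd] := top.
Qed.

End GradedSequences.

Arguments gdiff_hom [K n C] _ i [k l m].

(** * Mapping cones *)

Section MappingCone.
Variables (K : fieldType) (n : nat).
Local Notation S := {mpoly K[n]}.
Implicit Types (p q : S) (I J : S -> Prop) (F G L : graded_free_complex K n).

(* The mapping cone of phi, a chain map of augmented complexes from L(-e) to G; the
   summand S of the augmented L becomes the new generator phi 0 of degree e. *)
Definition cone G L (e : nat)
    (phi : forall i, 'M[S]_(grk (augmented L) i, grk (augmented G) i)) :
    graded_free_complex K n :=
  @GradedFreeComplex K n (fun i => rk G i + grk (augmented L) i)%N
    (fun i k => match split k with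
                | inl a => deg a
                | inr b => gdeg b + e
                end)%N
    (fun i => block_mx (diff G i) 0 (phi i.+1) (- gdiff (augmented L) i))
    (col_mx (aug G) (phi 0)).

Lemma cone_degl G L e phi i (a : 'I_(rk G i)) :
  @deg _ _ (@cone G L e phi) i (lshift _ a) = deg a.
Proof.
rewrite /=; case: split_ordP => j /eqP; rewrite ?eq_lrshift //.
by move/eqP/lshift_inj ->.
Qed.

Lemma cone_degr G L e phi i (b : 'I_(grk (augmented L) i)) :
  @deg _ _ (@cone G L e phi) i (rshift _ b) = (gdeg b + e)%N.
Proof.
rewrite /=; case: split_ordP => j /eqP; rewrite ?eq_rlshift //.
by move/eqP/rshift_inj ->.
Qed.

(** A nonzero constant is a term of degree 0 and would force [ds l = dr k + e]. *)
Lemma mxhom_const0 e r s (dr : 'I_r -> nat) (ds : 'I_s -> nat)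
    (A : 'M[S]_(r, s)) k l :
  mxhom e dr ds A -> (ds l < dr k + e)%N -> (A k l)@_0%MM = 0.
Proof.
move=> hA lt; apply/eqP; rewrite mcoeff_eq0; apply/negP => /hA.
by rewrite mdeg0 => eq; rewrite -eq ltnn in lt.
Qed.

(** Here I = J + (f), and multiplication by [f] embeds S/(J : f), twisted by [e], into S/J with
    cokernel S/I; the cone of a lift of this map is therefore exact. The two degree inequalities
    give minimality: they exclude constants from the blocks [phi i.+1] and from [aug L], which
    becomes part of a differential. *)
Lemma cone_resolution I J f e G L : f \is e.-homog ->
  minimal_graded_free_resolution J G ->
  minimal_graded_free_resolution (colon J f) L ->
  (forall g, I g <-> exists a, J (g - a * f)) ->
  (forall i (l : 'I_(rk G i)) (k : 'I_(rk L i)), deg l < deg k + e)%N ->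
  (forall k : 'I_(rk L 0), 0 < deg k)%N ->
  exists phi, minimal_graded_free_resolution I (cone e (G := G) (L := L) phi).
Proof.
move=> hf hG hL hI dGL dL.
have eG := augmented_exact hG; have eL := augmented_exact hL.
have f_hom : mxhom e (@gdeg _ _ (augmented L) 0) (@gdeg _ _ (augmented G) 0) f%:M.
  move=> k l m; rewrite !ord1 mxE eqxx mulr1n => mf.
  by rewrite /= addn0 (dhomogP _ _ _ hf).
have f_lift : exists X,
    gdiff (augmented L) 0 *m f%:M = X *m gdiff (augmented G) 0.
  suff /fin_all_exists[X hX] k : exists w,
      row k (aug L *m f%:M) = w *m aug G.
    by exists (\matrix_k X k); apply/row_matrixP => k; rewrite [RHS]row_mul rowK -hX.
  have /(aug_image hG)[w hw] : colon J f (aug L k 0).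
    apply/(aug_image hL); exists (delta_mx 0 k).
    by rewrite -rowE; apply/matrixP => a b; rewrite !mxE !ord1 eqxx mulr1n.
  exists w; rewrite -hw; apply/matrixP => a b.
  by rewrite mul_mx_scalar !mxE !ord1 eqxx mulr1n mulrC.
have [phi phi0 hphi] : exists2 phi : forall i,
    'M_(grk (augmented L) i, grk (augmented G) i), phi 0 = f%:M & forall i,
    mxhom e (@gdeg _ _ (augmented L) i) (@gdeg _ _ (augmented G) i) (phi i) /\
    phi i.+1 *m gdiff (augmented G) i = gdiff (augmented L) i *m phi i.
  by exists (@chain_lift _ _ (augmented L) (augmented G) e f%:M) => //; apply: chain_liftP.
exists phi.
have Lmin i k l : (gdiff (augmented L) i k l)@_0%MM = 0.
  case: i k l => [|i] k l; last exact: (diff_min hL).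
  by apply: (mxhom_const0 (gdiff_hom eL 0)); rewrite /= addn0.
split.
- move=> i k l m.
  case: (@split_ordP (rk G i.+1) (grk (augmented L) i.+1) k) => {}k ->;
  case: (@split_ordP (rk G i) (grk (augmented L) i) l) => {}l ->;
    rewrite ?cone_degl ?cone_degr.
  + by rewrite block_mxEul => /(diff_homog hG).
  + by rewrite block_mxEur mxE msupp0.
  + by rewrite block_mxEdl => /((hphi i.+1).1 k l m).
  + rewrite block_mxEdr mxE (perm_mem (msuppN _)).
    by move/(gdiff_hom eL i) => h; rewrite addnA h addn0.
- move=> k; case: (@split_ordP (rk G 0) (grk (augmented L) 0) k) => {}k ->.
    by rewrite cone_degl col_mxEu; apply: (aug_homog hG).
  by rewrite cone_degr col_mxEd phi0 !ord1 mxE eqxx mulr1n.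
- move=> g; rewrite hI; split=> [[a /(aug_image hG)[w hw]]|[v hv]].
    exists (row_mx w a%:M); rewrite /= mul_row_col phi0 -hw -scalar_mxM -raddfD /=.
    by rewrite subrK.
  rewrite -[v]hsubmxK /= mul_row_col phi0 in hv.
  exists (rsubmx v 0 0); apply/(aug_image hG); exists (lsubmx v).
  rewrite raddfB /= hv; apply/matrixP => a b; rewrite !mxE !ord1 /=.
  by rewrite big_ord1 !mxE eqxx !mulr1n addrK.
- move=> v; rewrite -[v]hsubmxK /= mul_row_col.
  set a := lsubmx _; set b := rsubmx _; split.
    move=> ab0.
    (* A relation [a *m aug G + b *m phi 0 = 0] puts the coefficient [b] in the colon ideal, so [b]
       lifts to [c] along [aug L]. Correcting [a] by [c *m phi 1] leaves a relation among the
       generators of [J] alone. The witness uses [- c] because the cone negates the differential of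
       [L]. *)
    have /(aug_image hL)[c hc] : colon J f (b 0 0).
      apply/(aug_image hG); exists (- a).
      rewrite mulNmx; move/eqP: ab0; rewrite addr_eq0 phi0 => /eqP->; rewrite opprK.
      by apply/matrixP => x y; rewrite !mxE !ord1 big_ord1 !mxE eqxx !mulr1n.
    have bE : b = c *m aug L.
      by rewrite -hc; apply/matrixP => x y; rewrite !mxE !ord1 eqxx mulr1n.
    have : (a + c *m phi 1) *m aug G = 0.
      by rewrite mulmxDl -mulmxA (hphi 0).2 mulmxA -bE.
    case/(aug_exact hG) => d hd; exists (row_mx d (- c)).
    rewrite mul_row_block mulmx0 add0r !mulNmx mulmxN opprK -bE.
    by rewrite -hd addrK.
  case=> w; rewrite -[w]hsubmxK mul_row_block mulmx0 add0r => /eq_row_mx[-> ->].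
  have h1 : diff G 0 *m aug G = 0 := gdiffM eG 0.
  have h2 : phi 1 *m aug G = aug L *m phi 0 := (hphi 0).2.
  by rewrite mulmxDl -!mulmxA h1 h2 mulmx0 add0r mulNmx mulmxN subrr.
- move=> i v; rewrite -[v]hsubmxK /= mul_row_block mulmx0 add0r.
  set a := lsubmx _; set b := rsubmx _; split.
    rewrite -[0]row_mx0 => /eq_row_mx[ab0 /eqP].
    rewrite mulmxN oppr_eq0 => /eqP /(gdiff_exact eL)[c bE].
    have : (a + c *m phi i.+2) *m diff G i = 0.
      by rewrite mulmxDl -mulmxA (hphi i.+1).2 mulmxA -bE.
    case/(diff_exact hG) => d hd; exists (row_mx d (- c)).
    rewrite mul_row_block mulmx0 add0r mulNmx mulmxN mulNmx opprK -bE.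
    by rewrite -hd addrK.
  case=> w; rewrite -[w]hsubmxK mul_row_block mulmx0 add0r => /eq_row_mx[-> ->].
  have h1 : diff G i.+1 *m diff G i = 0 := gdiffM eG i.+1.
  have h2 : phi i.+2 *m diff G i = gdiff (augmented L) i.+1 *m phi i.+1 :=
    (hphi i.+1).2.
  rewrite mulmxDl -!mulmxA h1 h2 mulmx0 add0r !mulNmx !mulmxN opprK.
  by rewrite (gdiffM eL) mulmx0 subrr row_mx0.
- move=> i k l /=.
  case: (@split_ordP (rk G i.+1) (grk (augmented L) i.+1) k) => {}k ->;
  case: (@split_ordP (rk G i) (grk (augmented L) i) l) => {}l ->.
  + by rewrite block_mxEul; apply: (diff_min hG).
  + by rewrite block_mxEur mxE mcoeff0.
  + by rewrite block_mxEdl; apply: (mxhom_const0 (hphi i.+1).1); apply: dGL.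
  + by rewrite block_mxEdr mxE mcoeffN Lmin oppr0.
Qed.
End MappingCone.

(** * Monomial ideals with linear quotients *)

Lemma ideal_gen_rcons (R : comNzRingType) (gs : seq R) (g f : R) :
  ideal_gen (rcons gs g) f <-> exists a, ideal_gen gs (f - a * g).
Proof.
split=> [[c fE]|[a [c fE]]].
  exists (c (size gs)), c; rewrite fE size_rcons big_ord_recr /=.
  rewrite nth_rcons ltnn eqxx addrK; apply: eq_bigr => i _.
  by rewrite nth_rcons ltn_ord.
exists (fun i => if (i < size gs)%N then c i else a).
rewrite size_rcons big_ord_recr /= nth_rcons ltnn eqxx.
apply/eqP; rewrite -subr_eq fE; apply/eqP/eq_bigr => i _.
by rewrite ltn_ord nth_rcons ltn_ord.
Qed.

Section MonomialIdeals.
Variables (K : fieldType) (n : nat).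
Local Notation S := {mpoly K[n]}.
Implicit Types (f g : S) (I J : S -> Prop) (F G L : graded_free_complex K n).
Implicit Types (m : 'X_{1..n}) (ms : seq 'X_{1..n}).

(** Induct on the last generator [m1]: the terms of [g] divisible by it add up to a multiple [a *
    'X_[m1]], and the other terms must be divisible by earlier generators. *)
Lemma ideal_gen_monomial ms g :
  ideal_gen [seq 'X_[m] : S | m <- ms] g <->
  (forall m, m \in msupp g -> exists2 m', m' \in ms & (m' <= m)%MM).
Proof.
elim/last_ind: ms g => [|ms m1 IH] g.
  split=> [[c ->] m|h]; first by rewrite big_ord0 msupp0.
  exists (fun=> 0); rewrite big_ord0; apply/msuppnil0.
  by case: (msupp g) h => // m s /(_ m); rewrite mem_head => -[].
rewrite map_rcons ideal_gen_rcons; split=> [[a /IH h] m mg|h].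
  have [/h[m' m'ms le]|mN] := boolP (m \in msupp (g - a * 'X_[m1])).
    by exists m' => //; rewrite mem_rcons inE m'ms orbT.
  have : m \in msupp (a * 'X_[m1]).
    rewrite mcoeff_msupp; apply: contraTneq mg => am0.
    by move: mN; rewrite mcoeff_msupp negbK mcoeffB am0 subr0 -mcoeff_eq0.
  rewrite (perm_mem (msuppMX _ _)) => /mapP[m2 _ ->]; exists m1.
    by rewrite mem_rcons mem_head.
  exact: lem_addr.
pose a := \sum_(m <- msupp g | (m1 <= m)%MM) g@_m *: 'X_[m - m1] : S.
have aE m : (a * 'X_[m1])@_m = if (m1 <= m)%MM then g@_m else 0.
  rewrite mulr_suml raddf_sum /=.
  under eq_bigr => k le do rewrite -scalerAl -mpolyXD submK // mcoeffZ mcoeffX.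
  have [mg|mNg] := boolP (m \in msupp g).
    rewrite big_mkcond (bigD1_seq m) ?msupp_uniq //= eqxx mulr1.
    by rewrite big1 ?addr0 // => k /negPf->; rewrite mulr0 if_same.
  rewrite (memN_msupp_eq0 mNg) if_same big_seq_cond big1 // => k /andP[kg _].
  by case: eqP => [km|_]; rewrite ?mulr0 // -km kg in mNg *.
exists a; apply/IH => m; rewrite mcoeff_msupp mcoeffB aE.
case: ifP => [_|mle]; rewrite ?subrr ?eqxx // subr0 -mcoeff_msupp => /h[m'].
by rewrite mem_rcons inE => /predU1P[->|]; [rewrite mle | exists m'].
Qed.

Lemma colon_monomial ms m1 g :
  colon (ideal_gen [seq 'X_[m] : S | m <- ms]) 'X_[m1] g <->
  (forall m, m \in msupp g -> exists2 m', m' \in ms & (m' <= m1 + m)%MM).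
Proof.
rewrite /colon ideal_gen_monomial; split=> h m.
  move=> mg; apply: h; rewrite (perm_mem (msuppMX _ _)).
  exact: map_f.
by rewrite (perm_mem (msuppMX _ _)) => /mapP[m2 /h h2 ->].
Qed.

Lemma ideal_gen_variables (Y : seq 'I_n) g :
  ideal_gen [seq 'X_v : S | v <- Y] g <->
  (forall m, m \in msupp g -> exists2 v, v \in Y & m v != 0%N).
Proof.
rewrite (map_comp (fun m => 'X_[m]) (@mnm1 n)) ideal_gen_monomial.
split=> h m /h[].
  by move=> _ /mapP[v vY ->]; rewrite lep1mP => mv; exists v.
by move=> v vY mv; exists U_(v)%MM; rewrite ?map_f ?lep1mP.
Qed.

Lemma resolution_ext I J F : (forall f, I f <-> J f) ->
  minimal_graded_free_resolution I F -> minimal_graded_free_resolution J F.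
Proof. by move=> IJ [? ? ai ? ? ?]; split=> // f; rewrite -IJ. Qed.

Lemma resolution_nil : exists2 F : graded_free_complex K n,
  minimal_graded_free_resolution (ideal_gen [::]) F & forall i, rk F i = 0%N.
Proof.
exists (@GradedFreeComplex K n (fun=> 0%N) (fun _ _ => 0%N) (fun=> 0) 0) => //.
have ex (v : 'rV[S]_0) (M : 'M[S]_0) :
    v *m M = 0 <-> exists w : 'rV[S]_0, v = w *m (0 : 'M_0).
  by split=> _; rewrite ?thinmx0 //; exists 0; rewrite !thinmx0.
split=> //=.
- by move=> i [].
- by case.
- move=> f; split=> [[c ->]|[v]].
    by exists 0; rewrite big_ord0 mulmx0 raddf0.
  rewrite mulmx0 => /matrixP/(_ 0 0); rewrite !mxE eqxx mulr1n => ->.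
  by exists (fun=> 0); rewrite big_ord0.
- move=> v; rewrite mulmx0; split=> // _.
  by exists 0; rewrite mulmx0 thinmx0.
- by move=> i [].
Qed.

(** This is the Koszul complex, built one variable at a time. A new variable [v] is a nonzerodivisor
    modulo the ideal of [Y], so the colon ideal is that ideal again and the cone joins two copies of
    one resolution. *)
Lemma resolution_variables (Y : seq 'I_n) : uniq Y ->
  exists F : graded_free_complex K n,
  [/\ minimal_graded_free_resolution (ideal_gen [seq 'X_v | v <- Y]) F,
      forall i, (0 < rk F i)%N = (i < size Y)%N &
      forall i (k : 'I_(rk F i)), deg k = i.+1].
Proof.
elim/last_ind: Y => [_|Y v IH].
  have [F hF rF] := resolution_nil; exists F; split=> // i.
    by rewrite rF.
  by move=> k; have := leq_ltn_trans (leq0n k) (ltn_ord k); rewrite rF.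
rewrite rcons_uniq => /andP[vY /IH[G [hG rG dG]]].
have hL : minimal_graded_free_resolution
    (colon (ideal_gen [seq 'X_v : S | v <- Y]) 'X_v) G.
  apply: resolution_ext hG => g.
  rewrite (map_comp (fun m => 'X_[m]) (@mnm1 n)) colon_monomial -map_comp.
  rewrite ideal_gen_variables; split=> h m /h[].
    move=> w wY mw; exists U_(w)%MM; first exact: map_f.
    by rewrite lep1mP mnmDE addn_eq0 (negPf mw) andbF.
  move=> _ /mapP[w wY ->]; rewrite lep1mP mnmDE mnm1E.
  by case: (eqVneq v w) vY => [->|_ _]; [rewrite wY | exists w].
have [||||phi hF] := @cone_resolution K n (ideal_gen [seq 'X_v | v <- rcons Y v])
  _ 'X_v 1 G G _ hG hL.
- by rewrite dhomogX; apply/eqP/mdeg1.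
- by move=> g; rewrite map_rcons ideal_gen_rcons.
- by move=> i l k; rewrite !dG addn1.
- by move=> k; rewrite dG.
exists (cone 1 phi); split=> //.
  case=> [|i]; rewrite size_rcons /= ?addn1 // addn_gt0 !rG ltnS orbC.
  by case: ltnP => //= h; rewrite ltnNge ltnW.
move=> i k.
case: (@split_ordP (rk G i) (grk (augmented G) i) k) => {}k ->.
  by rewrite cone_degl dG.
by rewrite cone_degr; case: i k => [|i] k /=; rewrite ?dG ?addn1.
Qed.

(** Add one cone over a Koszul complex per generator. The bound on [deg] serves the induction: in
    place [i] the earlier part has degrees at most [mdeg (mon x) + i], while the Koszul generators
    mapping there have degree [mdeg (mon x) + i.+1], which is the strict inequality minimality asks
    for. *)
Lemma resolution_linear_quotients (T : eqType) (mon : T -> 'X_{1..n})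
    (Y : T -> {set 'I_n}) (s : seq T) :
  (forall s1 x s2, s = s1 ++ x :: s2 -> forall g,
     colon (ideal_gen [seq 'X_[mon y] | y <- s1]) 'X_[mon x] g <->
     ideal_gen [seq 'X_v | v in Y x] g) ->
  pairwise (fun x y => mdeg (mon x) <= mdeg (mon y))%N s ->
  exists F : graded_free_complex K n,
  [/\ minimal_graded_free_resolution (ideal_gen [seq 'X_[mon x] : S | x <- s]) F,
      forall i, (0 < rk F i)%N = has (fun x => i <= #|Y x|)%N s &
      forall i (k : 'I_(rk F i)), exists2 x, x \in s &
        (deg k <= mdeg (mon x) + i)%N].
Proof.
elim/last_ind: s => [_ _|s x IH hs].
  have [F hF rF] := resolution_nil; exists F; split=> // i.
    by rewrite rF.
  by move=> k; have := leq_ltn_trans (leq0n k) (ltn_ord k); rewrite rF.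
rewrite pairwise_rcons => /andP[/allP le_x s_sorted].
have [|//|G [hG rG dG]] := IH.
  move=> s1 y s2 sE; apply: (hs s1 y (rcons s2 x)).
  by rewrite sE rcons_cat.
have [L [hL rL dL]] := resolution_variables (enum_uniq (mem (Y x))).
have {}hL : minimal_graded_free_resolution
    (colon (ideal_gen [seq 'X_[mon y] : S | y <- s]) 'X_[mon x]) L.
  by apply: resolution_ext hL => g; rewrite (hs s x [::]) // cats1.
have [||||phi hF] := @cone_resolution K n
  (ideal_gen [seq 'X_[mon y] | y <- rcons s x]) _ 'X_[mon x] (mdeg (mon x))
  G L _ hG hL.
- by rewrite dhomogX.
- by move=> g; rewrite map_rcons ideal_gen_rcons.
- move=> i l k; rewrite dL; have [y /le_x le_yx /leq_ltn_trans->] // := dG _ l.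
  by rewrite addSn ltnS addnC leq_add2l.
- by move=> k; rewrite dL.
exists (cone (mdeg (mon x)) phi); split=> //.
  rewrite -cardE in rL; case=> [|i]; rewrite has_rcons /= ?addn1 //.
  by rewrite addn_gt0 rG rL orbC.
move=> i k.
case: (@split_ordP (rk G i) (grk (augmented L) i) k) => {}k ->.
  rewrite cone_degl; have [y ys le] := dG _ k.
  by exists y => //; rewrite mem_rcons inE ys orbT.
exists x; first by rewrite mem_rcons mem_head.
by rewrite cone_degr addnC leq_add2l; case: i k => [|i] k //=; rewrite dL.
Qed.

End MonomialIdeals.

(** * Squarefree monomial ideals and keys *)

(** The number [a * M + b] codes the pair (a, b) for the lexicographic order; the refined keys below
    are of this form. *)
Lemma lex_lt M a b c d : (b < M)%N -> (d < M)%N ->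
  (a * M + b < c * M + d)%N = (a < c)%N || (a == c) && (b < d)%N.
Proof.
move=> bM dM; have [ac|ca|->] /= := ltngtP a c; last by rewrite ltn_add2l.
  rewrite (leq_trans _ (leq_addr _ _)) // (leq_trans _ (leq_mul ac (leqnn M))) //.
  by rewrite mulSn addnC ltn_add2r.
apply/negbTE; rewrite -leqNgt (leq_trans _ (leq_addr _ _)) //.
rewrite (leq_trans _ (leq_mul ca (leqnn M))) // mulSn addnC leq_add2r.
exact: ltnW.
Qed.

Lemma lex_le M a b c d : (b < M)%N -> (d < M)%N ->
  (a * M + b <= c * M + d)%N = (a < c)%N || (a == c) && (b <= d)%N.
Proof.
by move=> bM dM; rewrite leqNgt lex_lt //; case: (ltngtP a c); rewrite //= -leqNgt.
Qed.

Section SetMonomials.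
Variables (K : fieldType) (V : finType).
Local Notation S := {mpoly K[#|V|]}.
Implicit Types (A D : {set {set V}}) (F G H : {set V}) (key : {set V} -> nat).

Definition set_monomial F : 'X_{1..#|V|} := (\sum_(v in F) U_(enum_rank v))%MM.

Lemma set_monomialE F v : set_monomial F (enum_rank v) = (v \in F).
Proof.
rewrite mnm_sumE; under eq_bigr => w _ do rewrite mnm1E (inj_eq enum_rank_inj).
have [vF|vNF] := boolP (v \in F).
  rewrite (bigD1 v) //= eqxx big1 ?addn0 // => w /andP[_ /negPf->] //.
by rewrite big1 // => w wF; case: eqP => // wv; rewrite -wv wF in vNF.
Qed.

Lemma mdeg_set_monomial F : mdeg (set_monomial F) = #|F|.
Proof.
by rewrite mdeg_sum (eq_bigr (fun=> 1%N)) ?sum1_card // => v _; rewrite mdeg1.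
Qed.

Lemma set_monomial_leP F (m : 'X_{1..#|V|}) :
  reflect {in F, forall v, m (enum_rank v) != 0%N} (set_monomial F <= m)%MM.
Proof.
apply: (iffP mnm_lepP) => [le v vF|h i].
  by rewrite -lt0n (leq_trans _ (le _)) // set_monomialE vF.
rewrite -(enum_valK i) set_monomialE; case: (boolP (_ \in F)) => // /h.
by rewrite lt0n.
Qed.

Lemma set_monomial_le F G : (set_monomial F <= set_monomial G)%MM = (F \subset G).
Proof.
by apply/set_monomial_leP/subsetP => h v /h; rewrite set_monomialE ?eqb0 ?negbK.
Qed.

Lemma set_monomial_inj : injective set_monomial.
Proof.
move=> F G FG; apply/setP => v; have := set_monomialE F v.
by rewrite FG set_monomialE; do 2!case: (v \in _).
Qed.

(** * Facet ideals, orders given by keys, and projective dimension *)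

Lemma facet_idealE D g : facet_ideal K D g <->
  ideal_gen [seq 'X_[set_monomial F] : S | F <- enum (facets D)] g.
Proof.
rewrite /facet_ideal /image_mem; set s := map _ _; set t := map _ _.
suff -> : s = t by [].
by apply: eq_map => F; rewrite mprodXE.
Qed.

Lemma facet_ideal_monomial D g : facet_ideal K D g <->
  (forall m, m \in msupp g ->
     exists2 F, F \in facets D & (set_monomial F <= m)%MM).
Proof.
rewrite facet_idealE (map_comp (fun m => 'X_[m]) set_monomial).
rewrite ideal_gen_monomial; split=> h m /h[].
  by move=> _ /mapP[F + ->]; rewrite mem_enum; exists F.
by move=> F FD le; exists (set_monomial F); rewrite ?map_f ?mem_enum.
Qed.

(* Linear quotients for the family A ordered by increasing key; sets with the
   same key may come in any order. *)
Definition key_quotients A key : Prop :=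
  forall F G, F \in A -> G \in A -> F != G -> (key F <= key G)%N ->
  exists H v, [/\ H \in A, (key H < key G)%N, H :\: G = [set v] & v \in F].

(* The variables generating the colon ideal of the generator x^G. *)
Definition quotient_vars A key G : {set V} :=
  [set v | [exists H in A, (key H < key G)%N && (H :\: G == [set v])]].

Lemma quotient_varsP A key G v :
  reflect (exists H, [/\ H \in A, (key H < key G)%N & H :\: G = [set v]])
    (v \in quotient_vars A key G).
Proof.
rewrite inE; apply: (iffP existsP) => [[H /and3P[? ? /eqP ?]]|[H [? ? HG]]].
  by exists H.
by exists H; apply/and3P; rewrite HG eqxx.
Qed.

(** Sort the facets by [key]. What precedes [G] contains all facets of smaller key and perhaps some
    of equal key; [key_quotients] handles both, so the colon ideal is generated by [quotient_vars]
    however ties are broken. *)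
Lemma pd_facet_ideal D key :
  facets D != set0 -> key_quotients (facets D) key ->
  {in facets D &, forall F G, (key F <= key G)%N -> (#|F| <= #|G|)%N} ->
  pd (facet_ideal K D) =
    (\max_(G in facets D) #|quotient_vars (facets D) key G|)%N.
Proof.
move=> D0 lq card_mono; set A := facets D in D0 lq card_mono *.
pose le := relpre key leq.
have le_total : total le by move=> F G; apply: leq_total.
have le_trans : transitive le by move=> F G H; apply: leq_trans.
pose s := sort le (enum A).
have mem_s F : (F \in s) = (F \in A) by rewrite mem_sort mem_enum.
have s_uniq : uniq s by rewrite sort_uniq enum_uniq.
have s_sorted : pairwise le s by rewrite -sorted_pairwise // sort_sorted.
pose Y G := [set enum_rank v | v in quotient_vars A key G].
have [||F [hF rF _]] :=
  @resolution_linear_quotients K #|V| _ set_monomial Y s.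
- move=> s1 G s2 sE g.
  have prefix H : H \in s1 -> [/\ H \in A, H != G & (key H <= key G)%N].
    move=> Hs1; rewrite -mem_s sE mem_cat Hs1; split=> //.
      apply: contraTneq s_uniq => HG; rewrite sE cat_uniq /= -HG Hs1 /=.
      by rewrite andbF.
    move: s_sorted; rewrite sE pairwise_cat => /and3P[/allrelP h _ _].
    by apply: (h H G Hs1); rewrite mem_head.
  have in_prefix H : H \in A -> (key H < key G)%N -> H \in s1.
    rewrite -mem_s sE mem_cat => /orP[//|Hs2] ltHG.
    move: s_sorted; rewrite sE pairwise_cat /= => /and3P[_ _ /andP[/allP h _]].
    move: Hs2; rewrite inE => /predU1P[HG|/h]; first by rewrite HG ltnn in ltHG.
    by rewrite /le /= leqNgt ltHG.
  have AG : G \in A by rewrite -mem_s sE mem_cat mem_head orbT.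
  rewrite (map_comp (fun m => 'X_[m]) set_monomial) colon_monomial.
  rewrite ideal_gen_variables; split=> h m /h[].
    (* If x^H divides x^G times a monomial, then the exchange variable [v], being in [H] but not in
       [G], divides that monomial. *)
    move=> _ /mapP[H /prefix[AH HG le_HG] ->] /set_monomial_leP le_m.
    have [H' [v [AH' lt_H' H'G vH]]] := lq _ _ AH AG HG le_HG.
    exists (enum_rank v).
      by rewrite mem_enum imset_f //; apply/quotient_varsP; exists H'.
    have := le_m v vH; rewrite mnmDE set_monomialE.
    by have := set11 v; rewrite -H'G inE => /andP[/negPf-> _].
  move=> i; rewrite mem_enum => /imsetP[v /quotient_varsP[H [AH lt_H HG]] ->] mv.
  exists (set_monomial H); first by rewrite map_f ?in_prefix.
  apply/set_monomial_leP => w wH; rewrite mnmDE set_monomialE.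
  case: (boolP (w \in G)) => // wG; have : w \in H :\: G by rewrite inE wG.
  by rewrite HG inE => /eqP->.
- apply: sub_in_pairwise (allss s) s_sorted.
  move=> G H; rewrite !mem_s !mdeg_set_monomial; exact: card_mono.
apply: (pd_resolution (F := F)).
  apply: resolution_ext hF => g; rewrite facet_ideal_monomial.
  rewrite (map_comp (fun m => 'X_[m]) set_monomial) ideal_gen_monomial.
  split=> h m /h[]; first by move=> _ /mapP[H + ->]; rewrite mem_s; exists H.
  by move=> H AH le_m; exists (set_monomial H); rewrite // map_f ?mem_s.
move=> i; rewrite rF; apply/hasP/idP => [[G]|le_i].
  rewrite mem_s (card_imset _ enum_rank_inj) => AG /leq_trans-> //.
  exact: (leq_bigmax_cond _ AG).
have [|G AG maxE] := @eq_bigmax_cond _ (mem A)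
  (fun G => #|quotient_vars A key G|).
  by rewrite card_gt0.
by exists G; rewrite ?mem_s // (card_imset _ enum_rank_inj) -maxE.
Qed.

End SetMonomials.

(** * From linear quotients to a key nondecreasing in cardinality *)

Section Facets.
Variables (K : fieldType) (V : finType).
Implicit Types (A D : {set {set V}}) (F G H : {set V}) (key : {set V} -> nat).

Lemma facets_antichain D : {in facets D &, forall F G, F \subset G -> F = G}.
Proof.
move=> F G; rewrite !inE => /maxsetP[_ maxF] /maxsetP[DG _] sFG.
by rewrite (maxF G DG sFG).
Qed.

(** The key is the position of x^F in the given list. For [F] before [G], the monomial of [F :\: G]
    lies in the colon ideal, so one of the generating variables divides it. That variable is itself
    in the colon ideal, which yields an earlier [H] with at most this one element outside [G]. *)
Lemma linear_quotients_key D : linear_quotients (facet_ideal K D) ->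
  exists2 key, key_quotients (facets D) key & {in facets D &, injective key}.
Proof.
case=> fs [fs_uniq fsE lq]; set A := facets D.
have memX m : facet_ideal K D 'X_[m] <->
    exists2 F, F \in A & (set_monomial F <= m)%MM.
  rewrite facet_ideal_monomial; split=> [|h m1]; first by apply; rewrite msuppX inE.
  by rewrite msuppX inE => /eqP->.
have fs_facet F : F \in A -> set_monomial F \in fs.
  move=> AF; apply/fsE; split; first by apply/memX; exists F => //; apply: lepm_refl.
  move=> m /memX[G AG le_Gm] le_mF.
  have GF : G = F.
    apply: (@facets_antichain D) => //; rewrite -set_monomial_le.
    exact: lepm_trans le_mF.
  apply/mnmP => i; apply/eqP; rewrite eqn_leq -{2}GF.
  by rewrite (mnm_lepP le_mF) (mnm_lepP le_Gm).
have facet_fs m : m \in fs -> exists2 F, F \in A & m = set_monomial F.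
  case/fsE => /memX[F AF le_Fm] min_m; exists F => //.
  by apply/esym/min_m => //; apply/memX; exists F => //; apply: lepm_refl.
pose key F := index (set_monomial F) fs.
have key_inj : {in A &, injective key}.
  move=> F G AF AG FG; apply: set_monomial_inj.
  by rewrite -(nth_index 0%MM (fs_facet _ AF)) -/(key F) FG nth_index ?fs_facet.
exists key => // F G AF AG FG.
rewrite leq_eqVlt => /predU1P[/key_inj FE|lt_FG]; first by rewrite FE ?eqxx in FG.
have [|Y hY] := lq (key G).
  by rewrite (leq_ltn_trans _ lt_FG) // index_mem fs_facet.
rewrite nth_index ?fs_facet // in hY.
have [||v vY nz] := (@ideal_gen_variables K _ (enum Y) 'X_[set_monomial (F :\: G)]).1
  _ (set_monomial (F :\: G)) _.
- apply/hY/colon_monomial => m; rewrite msuppX inE => /eqP->.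
  exists (set_monomial F); first by rewrite in_take ?fs_facet.
  apply/set_monomial_leP => v vF; rewrite mnmDE !set_monomialE inE vF andbT.
  by case: (v \in G).
- by rewrite msuppX inE.
rewrite -(enum_valK v) set_monomialE eqb0 negbK inE in nz.
set w := enum_val v in nz; have /andP[wNG wF] := nz.
have /colon_monomial/(_ U_(v)%MM)[] : colon (ideal_gen
    [seq 'X_[m] : {mpoly K[#|V|]} | m <- take (key G) fs])
    'X_[set_monomial G] 'X_v.
- apply/hY/ideal_gen_variables => m; rewrite msuppX inE => /eqP->.
  by exists v; rewrite ?mnm1E ?eqxx // -(enum_valK v).
- by rewrite msuppX inE.
move=> m m_take; have m_fs := mem_take m_take.
have [H AH mE] := facet_fs _ m_fs; rewrite {}mE in m_take m_fs *.
move=> /set_monomial_leP le_m; exists H, w.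
have lt_HG : (key H < key G)%N by rewrite -in_take.
have HG u : u \in H -> u \notin G -> u = w.
  move=> /le_m; rewrite mnmDE set_monomialE mnm1E => + /negPf uG.
  by rewrite uG eqb0 negbK => /eqP vE; rewrite /w vE enum_rankK.
split=> //; apply/setP => u; rewrite !inE; apply/andP/eqP => [[uG uH]|->].
  exact: HG.
(* Without [w], the facet [H] would lie inside [G], hence equal it, and could not come earlier. *)
split=> //; apply: contraLR lt_HG => wH; rewrite -leqNgt.
suff -> : H = G by [].
apply: (@facets_antichain D) => //; apply/subsetP => x xH.
by apply: contraNT wH => /(HG x xH) <-.
Qed.

(** All but one element of [F] lies in [F :&: G], which is a proper subset of [G]. *)
Lemma card_exchange F G v : F :\: G = [set v] -> ~~ (G \subset F) ->
  (#|F| <= #|G|)%N.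
Proof.
move=> FG GF; rewrite -(cardsID G F) FG cards1 addn1 proper_card //.
rewrite properE subsetIr; apply: contra GF => /subset_trans-> //.
exact: subsetIl.
Qed.

(* When key G < key F but #|F| < #|G|, exchanging F against G gives H with
   H :\: G inside F, #|H| < #|G| and key H < key F: induct on key F. *)
Lemma degree_key A key : {in A &, forall F G, F \subset G -> F = G} ->
  key_quotients A key -> {in A &, injective key} ->
  exists key', [/\ key_quotients A key', {in A &, injective key'} &
    {in A &, forall F G, (key' F <= key' G)%N -> (#|F| <= #|G|)%N}].
Proof.
move=> antiA lq key_inj; pose M := (\max_(F in A) key F).+1.
have ltM F : F \in A -> (key F < M)%N by move=> AF; rewrite ltnS leq_bigmax_cond.
pose key' F := (#|F| * M + key F)%N; exists key'.
have exch_le F G v : F \in A -> G \in A -> F :\: G = [set v] ->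
    (key F < key G)%N -> (#|F| <= #|G|)%N.
  move=> AF AG FG lt_FG; apply: card_exchange FG _.
  by apply: contraTN lt_FG => /antiA-> //; rewrite ltnn.
split.
- move=> F G; have [m] := ubnP (key F); elim: m F => // m IH F le_m AF AG FG.
  have [le_FG _|lt_GF] := leqP (key F) (key G).
    have [H [v [AH lt_HG HG vF]]] := lq F G AF AG FG le_FG.
    exists H, v; split=> //; rewrite lex_lt ?ltM // lt_HG andbT orbC -leq_eqVlt.
    exact: exch_le HG lt_HG.
  rewrite lex_le ?ltM // [(key F <= _)%N]leqNgt lt_GF andbF orbF => lt_cFG.
  have [||H [w [AH lt_HF HF wG]]] := lq G F AG AF; rewrite 1?eq_sym ?(ltnW lt_GF) //.
  have lt_cHG : (#|H| < #|G|)%N.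
    exact: leq_ltn_trans (exch_le _ _ _ AH AF HF lt_HF) lt_cFG.
  have [|||H' [v [AH' lt_H' H'G vH]]] := IH H _ AH AG.
  + exact: leq_trans lt_HF _.
  + by apply: contraTneq lt_cHG => ->; rewrite ltnn.
  + by rewrite lex_le ?ltM // lt_cHG.
  exists H', v; split=> //; apply: contraTT vH => vF.
  have := set11 v; rewrite -H'G inE => /andP[vG _].
  apply: contra vG => vH; have : v \in H :\: F by rewrite inE vF.
  by rewrite HF inE => /eqP->.
- move=> F G AF AG FG; apply: key_inj => //; apply/eqP; rewrite eqn_leq.
  have := leqnn (key' F); rewrite {2}FG lex_le ?ltM //.
  have := leqnn (key' F); rewrite {1}FG lex_le ?ltM //.
  by case: ltngtP => //= _ -> ->.
move=> F G AF AG; rewrite lex_le ?ltM // => /orP[/ltnW //|/andP[/eqP-> //]].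
Qed.

End Facets.

(** * Expansions *)

Section ExpansionKey.
Variables (V : finType) (D : {set {set V}}) (alpha : V -> nat).
Hypothesis alpha_gt0 : forall v, (0 < alpha v)%N.
Local Notation T := {v : V & 'I_(alpha v)}.
Local Notation E := (expansion_facets D alpha).
Implicit Types (F : {set V}) (G H : {set T}) (u w : T).

Definition base G : {set V} := [set tag u | u in G].

Lemma expansion_facetsP G :
  reflect ({in G &, injective tag} /\ base G \in facets D) (G \in E).
Proof.
rewrite [X in reflect _ X]in_set.
by apply: (iffP andP) => [[/dinjectiveP ? ?]|[/dinjectiveP]].
Qed.

Lemma card_base G : G \in E -> #|base G| = #|G|.
Proof. by case/expansion_facetsP => tag_inj _; apply: card_in_imset. Qed.

Lemma eq_tagged u w : tag u = tag w -> tagged u = tagged w :> nat -> u = w.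
Proof.
case: u w => [v i] [v' j] /= vv'; case: _ / vv' j => j ij.
by congr (existT _ _ _); apply: val_inj.
Qed.

(** Keep the part of [G] over [F] and add [u]. The copy [u] of the new vertex is arbitrary, so every
    copy of a quotient variable becomes one. *)
Lemma exchange_base G F u : G \in E -> F \in facets D ->
  F :\: base G = [set tag u] ->
  exists H, [/\ H \in E, base H = F & H :\: G = [set u]].
Proof.
move=> /expansion_facetsP[tag_inj _] FD FG.
have [uG uF] : tag u \notin base G /\ tag u \in F.
  by apply/andP; rewrite -in_setD FG set11.
have baseH : base (u |: [set w in G | tag w \in F]) = F.
  apply/setP => v; apply/imsetP/idP => [[w + ->]|vF].
    by rewrite !inE => /predU1P[->|/andP[]].
  have [/imsetP[w wG vE]|vG] := boolP (v \in base G).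
    by exists w; rewrite // !inE wG -vE vF orbT.
  have : v \in F :\: base G by rewrite inE vG.
  by rewrite FG inE => /eqP->; exists u; rewrite // setU11.
exists (u |: [set w in G | tag w \in F]); split=> //.
  apply/expansion_facetsP; split; last by rewrite baseH.
  have tagNu w : w \in G -> tag w != tag u.
    by move=> wG; apply: contraNneq uG => <-; apply: imset_f.
  move=> w w'; rewrite !inE => /predU1P[->|/andP[wG _]] /predU1P[->|/andP[w'G _]].
  - by [].
  - by move/esym/eqP; rewrite (negPf (tagNu _ w'G)).
  - by move/eqP; rewrite (negPf (tagNu _ wG)).
  - exact: tag_inj.
apply/setP => w; rewrite !inE; apply/andP/eqP => [[wG]|->].
  by rewrite (negPf wG) orbF => /eqP.
by rewrite eqxx; split=> //; apply: contra uG => /(imset_f tag).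
Qed.

Lemma exchange_fiber G u w : G \in E -> w \in G -> tag u = tag w -> u != w ->
  [/\ u |: G :\ w \in E, base (u |: G :\ w) = base G &
      (u |: G :\ w) :\: G = [set u]].
Proof.
move=> /expansion_facetsP[tag_inj GD] wG uw neq_uw.
have uG : u \notin G by apply: contra neq_uw => uG; rewrite (tag_inj u w).
have baseH : base (u |: G :\ w) = base G.
  apply/setP => v; apply/imsetP/imsetP => -[x + ->].
    by rewrite !inE => /predU1P[->|/andP[_]]; [exists w | exists x].
  have [->|xw xG] := eqVneq x w; first by exists u; rewrite ?setU11.
  by exists x; rewrite // !inE xw xG orbT.
split=> //.
  apply/expansion_facetsP; rewrite baseH; split=> //.
  have tagNu x : x != w -> x \in G -> tag x != tag u.
    by move=> xw xG; apply: contraNneq xw => xu; apply/eqP/tag_inj; rewrite ?xu.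
  move=> x y; rewrite !inE.
  move=> /predU1P[->|/andP[xw xG]] /predU1P[->|/andP[yw yG]].
  - by [].
  - by move/esym/eqP; rewrite (negPf (tagNu _ yw yG)).
  - by move/eqP; rewrite (negPf (tagNu _ xw xG)).
  - exact: tag_inj.
apply/setP => x; rewrite !inE; apply/andP/eqP => [[xG]|->].
  by rewrite (negPf xG) andbF orbF => /eqP.
by rewrite eqxx.
Qed.

Definition height G := (\sum_(u in G) tagged u)%N.

Definition fiber_height G v := (\sum_(u in G | tag u == v) tagged u)%N.

Lemma heightE G : height G = (\sum_v fiber_height G v)%N.
Proof. exact: partition_big. Qed.

Lemma fiber_height_tag G u : {in G &, injective tag} -> u \in G ->
  fiber_height G (tag u) = tagged u.
Proof.
move=> tag_inj uG; rewrite /fiber_height (big_pred1 u) // => w.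
apply/andP/eqP => [[wG /eqP/tag_inj->]|->] //.
Qed.

(** Fibre by fibre, [H] is no higher than [G]; the totals compare the other way, so all fibres
    agree. *)
Lemma height_le_eq G H : G \in E -> H \in E -> base G = base H ->
  (height G <= height H)%N ->
  {in G & H, forall u w, tag u = tag w -> (tagged w <= tagged u)%N} -> G = H.
Proof.
move=> EG EH eq_base le_GH le_HG; have eq_card := card_base EH.
rewrite -eq_base (card_base EG) in eq_card.
have [tag_injG _] := expansion_facetsP _ EG.
have [tag_injH _] := expansion_facetsP _ EH.
have le_fiber v : (fiber_height H v <= fiber_height G v)%N.
  have [/imsetP[w wH ->]|vH] := boolP (v \in base H).
    have /imsetP[u uG wu] : tag w \in base G by rewrite eq_base imset_f.
    by rewrite {2}wu !fiber_height_tag // le_HG.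
  rewrite /fiber_height big_pred0 // => w; apply: contraNF vH.
  by case/andP=> wH /eqP<-; apply: imset_f.
have [le_sum] := leqif_sum (P := xpredT) (fun v _ => leqif_eq (le_fiber v)).
rewrite eqn_leq le_sum -!heightE le_GH => /esym/forallP/= eq_fiber.
apply/eqP; rewrite eqEcard eq_card leqnn andbT; apply/subsetP => u uG.
have /imsetP[w wH uw] : tag u \in base H by rewrite -eq_base imset_f.
have := eqP (eq_fiber (tag u)); rewrite {1}uw !fiber_height_tag // => wu.
by rewrite (eq_tagged uw).
Qed.

Lemma height_exchange G u w : w \in G -> u \notin G ->
  (tagged u < tagged w)%N -> (height (u |: G :\ w) < height G)%N.
Proof.
move=> wG uG lt_uw; rewrite /height [X in (_ < X)%N](big_setD1 w wG) /=.
by rewrite big_setU1 ?ltn_add2r // !inE negb_and uG orbT.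
Qed.

(** * The order on the facets of the expansion and its quotient variables *)

Section Key.
Variable key : {set V} -> nat.
Hypothesis key_inj : {in facets D &, injective key}.

(** The multiplier exceeds every height, so base keys are compared first and heights second. *)
Definition expansion_key G : nat :=
  (key (base G) * (\sum_(u : T) tagged u).+1 + height G)%N.

Lemma height_lt G : (height G < (\sum_(u : T) tagged u).+1)%N.
Proof. by rewrite ltnS [leqRHS](bigID (mem G)) leq_addr. Qed.

Lemma expansion_key_lt G H : (expansion_key G < expansion_key H)%N =
  (key (base G) < key (base H))%N ||
  (key (base G) == key (base H)) && (height G < height H)%N.
Proof. by rewrite lex_lt ?height_lt. Qed.

Lemma expansion_key_le G H : (expansion_key G <= expansion_key H)%N =
  (key (base G) < key (base H))%N ||
  (key (base G) == key (base H)) && (height G <= height H)%N.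
Proof. by rewrite lex_le ?height_lt. Qed.

(** Over equal bases, [G1] has some copy lower than the one in [G] over the same vertex, since
    otherwise [height_le_eq] gives [G1 = G]; swap it in. Over distinct bases, lift an exchange of
    the original facets, adding the copy that [G1] uses. *)
Lemma key_quotients_expansion :
  key_quotients (facets D) key -> key_quotients E expansion_key.
Proof.
move=> lq G1 G EG1 EG neqG; rewrite expansion_key_le.
have [tag_inj1 D1] := expansion_facetsP _ EG1.
have [tag_inj DG] := expansion_facetsP _ EG.
have [eq_base|neq_base] := eqVneq (base G1) (base G).
  rewrite eq_base ltnn eqxx /= => le_height.
  have [[u w] /= /and4P[uG1 wG /eqP uw lt_uw]|min_w] :=
    pickP (fun p : T * T => [&& p.1 \in G1, p.2 \in G, tag p.1 == tag p.2 &
      tagged p.1 < tagged p.2])%N.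
    have neq_uw : u != w by apply: contraTneq lt_uw => ->; rewrite ltnn.
    have [EH baseH HG] := exchange_fiber EG wG uw neq_uw.
    exists (u |: G :\ w), u; split=> //.
    rewrite expansion_key_lt baseH eqxx orbC height_exchange //.
    by apply: contra neq_uw => uG; rewrite (tag_inj u w).
  have le_wu u w : u \in G1 -> w \in G -> tag u = tag w -> (tagged w <= tagged u)%N.
    move=> uG1 wG uw; rewrite leqNgt; apply/negP => lt_uw.
    by case/negP: (negbT (min_w (u, w))); apply/and4P; split=> //; apply/eqP.
  by case/eqP: neqG; apply: height_le_eq.
have lt_le : (key (base G1) <= key (base G))%N ->
  exists H u, [/\ H \in E, (expansion_key H < expansion_key G)%N,
    H :\: G = [set u] & u \in G1].
  case/(lq _ _ D1 DG neq_base) => F [v [FD lt_F FG /imsetP[u uG1 vE]]].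
  rewrite vE in FG; have [H [EH baseH HG]] := exchange_base EG FD FG.
  by exists H, u; split=> //; rewrite expansion_key_lt baseH lt_F.
by case/orP=> [/ltnW|/andP[/eqP eq_key _]]; apply: lt_le; rewrite ?eq_key.
Qed.

Lemma quotient_vars_expansion_sub G : G \in E ->
  quotient_vars E expansion_key G \subset
    [set u | tag u \in quotient_vars (facets D) key (base G)] :|:
    [set u | tag u \in base G] :\: G.
Proof.
move=> EG; have [tag_inj DG] := expansion_facetsP _ EG.
apply/subsetP => u /quotient_varsP[H [EH lt_HG HG]].
have [tag_injH DH] := expansion_facetsP _ EH.
have [uG uH] : u \notin G /\ u \in H by apply/andP; rewrite -in_setD HG set11.
rewrite in_setU in_setD uG [X in _ || X]in_set.
have [|uB] := boolP (tag u \in base G); first by rewrite orbT.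
rewrite orbF in_set; apply/quotient_varsP; exists (base H).
have HGE : base H :\: base G = [set tag u].
  apply/setP => v; rewrite !inE; apply/andP/eqP => [[vG /imsetP[w wH vE]]|->].
    rewrite vE in vG *; congr tag; apply/eqP; rewrite -in_set1 -HG inE wH andbT.
    by apply: contra vG; apply: imset_f.
  by rewrite uB imset_f.
split=> //; move: lt_HG; rewrite expansion_key_lt.
case/orP=> // /andP[/eqP/key_inj eq_base _].
by rewrite -eq_base // imset_f in uB.
Qed.

(** Every vertex takes its last copy, of index [alpha v - 1]; this is the facet at which the upper
    bound is attained. *)
Definition top_facet F : {set T} :=
  [set u : T | (tag u \in F) && ((tagged u).+1 == alpha (tag u))].

Lemma base_top_facet F : base (top_facet F) = F.
Proof.
apply/setP => v; apply/imsetP/idP => [[u + ->]|vF]; first by rewrite inE => /andP[].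
have lt_v : ((alpha v).-1 < alpha v)%N by rewrite prednK.
exists (Tagged (fun v => 'I_(alpha v)) (Ordinal lt_v)) => //.
by rewrite inE /= vF prednK /=.
Qed.

Lemma top_facetP F : F \in facets D -> top_facet F \in E.
Proof.
move=> FD; apply/expansion_facetsP; rewrite base_top_facet; split=> //.
move=> u w; rewrite !inE => /andP[_ /eqP uE] /andP[_ /eqP wE] uw.
by apply: eq_tagged => //; apply: succn_inj; rewrite uE wE uw.
Qed.

Lemma quotient_vars_top_facet F : F \in facets D ->
  [set u | tag u \in quotient_vars (facets D) key F] :|:
    [set u | tag u \in F] :\: top_facet F
  \subset quotient_vars E expansion_key (top_facet F).
Proof.
move=> FD; have EF := top_facetP FD.
apply/subsetP => u; rewrite !in_setU in_setD => /orP[|/andP[uF]]; rewrite in_set.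
  case/quotient_varsP => F' [F'D lt_F' F'F].
  rewrite -{1}(base_top_facet F) in F'F.
  have [H [EH baseH HG]] := exchange_base EF F'D F'F.
  apply/quotient_varsP; exists H; split=> //.
  by rewrite expansion_key_lt baseH base_top_facet lt_F'.
rewrite -{1}(base_top_facet F) => /imsetP[w wF uw].
have neq_uw : u != w by apply: contraNneq uF => ->.
have [EH baseH HG] := exchange_fiber EF wF uw neq_uw.
apply/quotient_varsP; exists (u |: top_facet F :\ w); split=> //.
rewrite expansion_key_lt baseH eqxx orbC height_exchange //.
move: wF; rewrite inE => /andP[_ /eqP wE]; rewrite -ltnS wE -uw.
(* Were [u] also the last copy of its vertex, it would be [w]. *)
have := ltn_ord (tagged u); rewrite leq_eqVlt => /predU1P[uE|//].
case/eqP: neq_uw; apply: eq_tagged => //; apply: succn_inj.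
by rewrite wE uE uw.
Qed.

End Key.
End ExpansionKey.

(** * Counting quotient variables and the two bounds *)

Lemma card_tag_preim (V : finType) (s : nat) (F : {set V}) :
  #|[set u : {v : V & 'I_s} | tag u \in F]| = (#|F| * s)%N.
Proof.
rewrite -sum1_card -sum_nat_const.
under eq_bigl => u do rewrite inE.
transitivity (\sum_(v in F) \sum_(j : 'I_s) 1)%N.
  by rewrite sig_big_dep; apply: eq_bigl => u; rewrite andbT.
by apply: eq_bigr => v _; rewrite sum1_card card_ord.
Qed.

Lemma cdim_pure (V : finType) (D : {set {set V}}) (F : {set V}) :
  pure_complex D -> F \in facets D -> cdim D + 1 = #|F|%:Z.
Proof.
move=> pureD FD; rewrite /cdim subrK; congr Posz; apply/eqP; rewrite eqn_leq.
have := FD; rewrite inE => /maxsetP[DF _].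
rewrite (leq_bigmax_cond _ DF) andbT; apply/bigmax_leqP => G DG.
have [H maxH sGH] := @maxset_exists _ (fun G => G \in D) _ DG.
by rewrite (pureD F H) ?subset_leq_card // inE.
Qed.

Theorem proposition3p8 (K : fieldType) (n : nat) (Delta : {set {set 'I_n}})
    (s : nat) :
  simplicial_complex Delta ->
  (0 < s)%N ->
  linear_quotients (facet_ideal K Delta) ->
  (pd (facet_ideal K (expansion Delta (fun=> s))))%:Z
    <= (pd (facet_ideal K Delta))%:Z * s%:Z + (cdim Delta + 1) * (s%:Z - 1)
  /\ (pure_complex Delta ->
      (pd (facet_ideal K (expansion Delta (fun=> s))))%:Z
        = (pd (facet_ideal K Delta))%:Z * s%:Z + (cdim Delta + 1) * (s%:Z - 1)).
Proof.
move=> [Delta0 _] s_gt0 /linear_quotients_key[key0 lq0 key0_inj].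
have [key [lq key_inj card_mono]] :=
  degree_key (@facets_antichain _ Delta) lq0 key0_inj.
pose A := facets Delta; pose E := expansion_facets Delta (fun=> s).
pose ekey := expansion_key (alpha := fun=> s) key.
have s0 (v : 'I_n) : (0 < s)%N by [].
have A_neq0 : A != set0.
  have [F maxF _] := @maxset_exists _ (fun G => G \in Delta) _ Delta0.
  by apply/set0Pn; exists F; rewrite inE.
have pdD := pd_facet_ideal K A_neq0 lq card_mono.
have pdE : pd (facet_ideal K (expansion Delta (fun=> s))) =
    (\max_(G in E) #|quotient_vars E ekey G|)%N.
  rewrite -[E]facets_expansion; apply: pd_facet_ideal;
    rewrite facets_expansion -/E.
  - have /set0Pn[F FA] := A_neq0; apply/set0Pn; exists (top_facet (fun=> s) F).
    exact: top_facetP.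
  - exact: key_quotients_expansion.
  move=> G H EG EH le_GH; rewrite -(card_base EG) -(card_base EH).
  have /expansion_facetsP[_ GA] := EG; have /expansion_facetsP[_ HA] := EH.
  apply: card_mono => //; move: le_GH; rewrite expansion_key_le.
  by case/orP=> [/ltnW//|/andP[/eqP-> //]].
have s1 : s%:Z - 1 = s.-1%:Z by rewrite -{1}(prednK s_gt0) -addn1 PoszD addrK.
(* [G] uses one of the [s] copies of each vertex of its base, leaving [s.-1]. *)
have card_fiber G : G \in E ->
    #|[set u | tag u \in base G] :\: G| = (#|base G| * s.-1)%N.
  move=> EG; rewrite cardsD (setIidPr _).
    by rewrite card_tag_preim -subn1 mulnBr muln1 (card_base EG).
  by apply/subsetP => u uG; rewrite inE imset_f.
pose P := (\max_(F in A) #|quotient_vars A key F|)%N.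
have le_pdE : (\max_(G in E) #|quotient_vars E ekey G| <=
    P * s + (\max_(F in Delta) #|F|) * s.-1)%N.
  apply/bigmax_leqP => G EG; have /expansion_facetsP[_ GA] := EG.
  apply: leq_trans (subset_leq_card (quotient_vars_expansion_sub key_inj EG)) _.
  apply: leq_trans (leq_card_setU _ _) _; rewrite card_fiber // card_tag_preim.
  apply: leq_add; rewrite leq_mul2r ?(leq_bigmax_cond _ GA) ?orbT //.
  have := GA; rewrite inE => /maxsetP[GD _].
  by rewrite (leq_bigmax_cond _ GD) orbT.
have cdimE : cdim Delta + 1 = (\max_(F in Delta) #|F|)%N%:Z by rewrite /cdim subrK.
rewrite pdD pdE s1 cdimE -!PoszM -PoszD lez_nat; split=> // pureD.
congr Posz; apply/eqP; rewrite eqn_leq le_pdE /=.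
(* Choose a facet with the most quotient variables. By purity it also has the maximal cardinality,
   so both terms of the bound are attained at its top facet. *)
have [|F FA PE] := @eq_bigmax_cond _ (mem A) (fun F => #|quotient_vars A key F|).
  by rewrite card_gt0.
have := cdim_pure pureD FA; rewrite cdimE => -[->].
have EF := top_facetP s0 FA.
apply: leq_trans (leq_bigmax_cond _ EF).
apply: leq_trans (subset_leq_card (quotient_vars_top_facet s0 key FA)).
rewrite cardsU (_ : _ :&: _ = set0) ?cards0 ?subn0.
  have := card_fiber _ EF; rewrite base_top_facet // => ->.
  by rewrite card_tag_preim -PE.
(* The two families of variables are disjoint because quotient variables of [F] lie outside [F]. *)
apply/eqP; rewrite -subset0; apply/subsetP => u.
rewrite in_setI in_setD => /and3P[]; rewrite in_set => /quotient_varsP[H [_ _ HF]] _.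
rewrite in_set => uF; have := set11 (tag u).
by rewrite -HF inE uF.
Qed.
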